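(* Let $q=2$, let $p\ge 1$, and let $l$ be the Norm-in-Norm loss with parameters $p$ and $q=2$ defined in the context, for vectors $\hat{\mathbf Q},\mathbf Q\in\mathbb R^N$ with $\hat b\neq0$, $b\neq 0$, at a point where the loss is differentiable. Let $\mathbf g=\frac{\partial l}{\partial\hat{\mathbf S}}$ and $\mathbf g_n=\frac{\partial l}{\partial\hat{\mathbf Q}}$. Then the gradient magnitude of $l$ satisfies $$\|\mathbf g_n\|^2=\frac{1}{\hat b^2}\left\{\|\mathbf g\|^2-\frac1N\langle\mathbf 1,\mathbf g\rangle^2-\langle\mathbf g,\hat{\mathbf S}\rangle^2\right\},$$ where the right side contains three terms. The first term is directly related to the gradient of the loss with respect to the normalized predicted quality scores, i.e., $\|\mathbf g\|^2$. The second term, $-\frac1N\langle\mathbf 1,\mathbf g\rangle^2$, is non-positive and is contributed by $\frac{\partial l}{\partial\hat a}$. The third term, $-\langle\mathbf g,\hat{\mathbf S}\rangle^2$, is non-positive and is contributed by $\frac{\partial l}{\partial\hat b}$. The contributions of $\frac{\partial l}{\partial\hat a}$ and $\frac{\partial l}{\partial\hat b}$ are independent.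
   Context: Norm-in-Norm loss with parameters $p,q\ge 1$. For $\hat{\mathbf Q}=(\hat Q_1,\dots,\hat Q_N)$ (predicted quality scores) and $\mathbf Q=(Q_1,\dots,Q_N)$ (subjective quality scores) in $\mathbb R^N$, set $$\hat a=\frac1N\sum_{i=1}^N\hat Q_i,\quad \hat b=\Big(\sum_{i=1}^N|\hat Q_i-\hat a|^q\Big)^{1/q},\quad a=\frac1N\sum_{i=1}^N Q_i,\quad b=\Big(\sum_{i=1}^N|Q_i-a|^q\Big)^{1/q},$$ $$\hat S_i=\frac{\hat Q_i-\hat a}{\hat b},\qquad S_i=\frac{Q_i-a}{b}\qquad(i=1,\dots,N),$$ with $\hat{\mathbf S}=(\hat S_1,\dots,\hat S_N)$ (normalized predicted quality scores) and $\mathbf S=(S_1,\dots,S_N)$. The loss is $$l(\hat{\mathbf Q},\mathbf Q)=\frac1c\sum_{i=1}^N|\hat S_i-S_i|^p,\qquad c=\begin{cases}2^pN^{1-p/q}& p<q,\\ 2^p& p\ge q.\end{cases}$$ $\frac{\partial l}{\partial\hat{\mathbf S}}$ is the gradient of $\mathbf s\mapsto\frac1c\sum_i|s_i-S_i|^p$ at $\mathbf s=\hat{\mathbf S}$. $\frac{\partial l}{\partial\hat{\mathbf Q}}$ is the full gradient of $\hat{\mathbf Q}\mapsto l(\hat{\mathbf Q},\mathbf Q)$ with $\mathbf Q$ fixed, where $\hat a,\hat b,\hat{\mathbf S}$ are functions of $\hat{\mathbf Q}$. $\frac{\partial l}{\partial\hat a}$ and $\frac{\partial l}{\partial\hat b}$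 are the derivatives of the loss with respect to the intermediate statistics $\hat a$ and $\hat b$ in the chain rule (backward propagation through $\hat S_i=(\hat Q_i-\hat a)/\hat b$, the statistics being treated as variables); for $q=2$ they equal $\frac{\partial l}{\partial\hat a}=-\frac1{\hat b}\langle\mathbf 1,\mathbf g\rangle$ and $\frac{\partial l}{\partial\hat b}=-\frac1{\hat b}\langle\mathbf g,\hat{\mathbf S}\rangle$. That their contributions are independent is to be read as: the second term involves only $\frac{\partial l}{\partial\hat a}$, the third only $\frac{\partial l}{\partial\hat b}$, and there is no cross term. $\mathbf 1=(1,\dots,1)\in\mathbb R^N$, $\langle\cdot,\cdot\rangle$ is the Euclidean inner product, and $\|\cdot\|$ is the Euclidean norm. *)

(* Defs.v *)
From HB Require Import structures.
From mathcomp Require Import all_boot all_order all_algebra.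
From mathcomp Require Import all_classical all_reals all_analysis.
Set Implicit Arguments.
Unset Strict Implicit.
Unset Printing Implicit Defensive.
Import Order.TTheory GRing.Theory Num.Theory.
Import numFieldNormedType.Exports.
Local Open Scope ring_scope.
Local Open Scope classical_set_scope.

(* The library norm on 'rV[R]_N is the sup norm: it gives the usual topology and
   differentiability, but it is not the Euclidean norm. *)
Definition dotv (R : realType) (N : nat) (u v : 'rV[R]_N) : R :=
  \sum_(i < N) u 0 i * v 0 i.

Definition enorm (R : realType) (N : nat) (u : 'rV[R]_N) : R :=
  Num.sqrt (dotv u u).

(* The vector of partial derivatives; 'D_v is a total operator, so this is
   meaningful only where the partial derivatives exist. *)
Definition gradient (R : realType) (N : nat) (f : 'rV[R]_N -> R)
    (x : 'rV[R]_N) : 'rV[R]_N :=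
  \row_(i < N) 'D_(delta_mx 0 i) f x.

Definition mean (R : realType) (N : nat) (Q : 'rV[R]_N) : R :=
  N%:R^-1 * \sum_(i < N) Q 0 i.

Definition deviation (R : realType) (N : nat) (q : R) (Q : 'rV[R]_N) : R :=
  (\sum_(i < N) `|Q 0 i - mean Q| `^ q) `^ q^-1.

(* The two statistics are separate arguments, so that the loss can be
   differentiated with respect to each of them. *)
Definition standardize (R : realType) (N : nat) (Q : 'rV[R]_N) (a b : R) :
    'rV[R]_N :=
  \row_(i < N) ((Q 0 i - a) / b).

Definition normalize (R : realType) (N : nat) (q : R) (Q : 'rV[R]_N) :
    'rV[R]_N :=
  standardize Q (mean Q) (deviation q Q).

Definition loss_const (R : realType) (N : nat) (p q : R) : R :=
  if p < q then 2 `^ p * N%:R `^ (1 - p / q) else 2 `^ p.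

(* The loss as a function of the normalized predicted scores s. *)
Definition score_loss (R : realType) (N : nat) (p q : R) (S s : 'rV[R]_N) : R :=
  (loss_const N p q)^-1 * \sum_(i < N) `|s 0 i - S 0 i| `^ p.

Definition nin_loss (R : realType) (N : nat) (p q : R) (Qhat Q : 'rV[R]_N) : R :=
  score_loss p q (normalize q Q) (normalize q Qhat).

(* The loss as a function of one of the statistics of Qhat, the other statistic
   and Qhat itself being held fixed. *)
Definition loss_of_mean (R : realType) (N : nat) (p q : R)
    (Qhat Q : 'rV[R]_N) (a : R) : R :=
  score_loss p q (normalize q Q) (standardize Qhat a (deviation q Qhat)).

Definition loss_of_deviation (R : realType) (N : nat) (p q : R)
    (Qhat Q : 'rV[R]_N) (b : R) : R :=
  score_loss p q (normalize q Q) (standardize Qhat (mean Qhat) b).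

(* Chain rule for Qhat |-> loss ((Qhat - a) / b): the direct path through Qhat,
   where g is the gradient with respect to the normalized scores, plus the paths
   through the two statistics, weighted by the derivatives da and db of the loss
   with respect to them; da = 0 or db = 0 cuts the corresponding path. *)
Definition backprop (R : realType) (N : nat) (q : R) (Qhat g : 'rV[R]_N)
    (da db : R) : 'rV[R]_N :=
  (deviation q Qhat)^-1 *: g
  + da *: gradient (@mean R N) Qhat
  + db *: gradient (@deviation R N q) Qhat.

(* Main.v *)
(* The Jacobian of Qhat |-> Shat is (I - 11^T / N - Shat Shat^T) / bhat. For
   q = 2 the vectors 1 and Shat are orthogonal, |1|^2 = N and |Shat|^2 = 1, so
   the Jacobian is 1 / bhat times the orthogonal projection onto the complement
   of the span of 1 and Shat, and Pythagoras' theorem gives the squared norm.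
   The two subtracted parts come from the paths through the mean and through
   the deviation, whose gradients are 1 / N and Shat. *)
Require Import Defs.
From HB Require Import structures.
From mathcomp Require Import all_boot all_order all_algebra.
From mathcomp Require Import all_classical all_reals all_analysis.
From mathcomp Require Import ring.
Set Implicit Arguments.
Unset Strict Implicit.
Unset Printing Implicit Defensive.
Import Order.TTheory GRing.Theory Num.Theory.
Import numFieldNormedType.Exports.
Local Open Scope ring_scope.
Local Open Scope classical_set_scope.

(** * Euclidean inner product on row vectors *)

Lemma dotvC (R : realType) N (u v : 'rV[R]_N) : dotv u v = dotv v u.
Proof. by apply: eq_bigr => i _; rewrite mulrC. Qed.

Lemma dotvDr (R : realType) N (u v w : 'rV[R]_N) :
  dotv u (v + w) = dotv u v + dotv u w.
Proof. by rewrite -big_split; apply: eq_bigr => i _; rewrite mxE mulrDr. Qed.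

Lemma dotvZr (R : realType) N a (u v : 'rV[R]_N) :
  dotv u (a *: v) = a * dotv u v.
Proof. by rewrite mulr_sumr; apply: eq_bigr => i _; rewrite mxE mulrCA. Qed.

Lemma dotvBr (R : realType) N (u v w : 'rV[R]_N) :
  dotv u (v - w) = dotv u v - dotv u w.
Proof. by rewrite dotvDr -scaleN1r dotvZr mulN1r. Qed.

Lemma dotvDl (R : realType) N (u v w : 'rV[R]_N) :
  dotv (u + v) w = dotv u w + dotv v w.
Proof. by rewrite dotvC dotvDr !(dotvC w). Qed.

Lemma dotvZl (R : realType) N a (u v : 'rV[R]_N) :
  dotv (a *: u) v = a * dotv u v.
Proof. by rewrite dotvC dotvZr dotvC. Qed.

Lemma dotv_delta (R : realType) N (u : 'rV[R]_N) i :
  dotv u (delta_mx 0 i) = u 0 i.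
Proof.
rewrite /dotv (bigD1 i) //= big1 => [|j ji]; rewrite mxE !eqxx ?mulr1 ?addr0//.
by rewrite (negPf ji) mulr0.
Qed.

Lemma dotv_ge0 (R : realType) N (u : 'rV[R]_N) : 0 <= dotv u u.
Proof. by apply: sumr_ge0 => i _; rewrite -expr2 sqr_ge0. Qed.

Lemma enorm_sqr (R : realType) N (u : 'rV[R]_N) : enorm u ^+ 2 = dotv u u.
Proof. by rewrite sqr_sqrtr// dotv_ge0. Qed.

(** * Mean, deviation and normalization for q = 2 *)

Lemma meanE (R : realType) N (u : 'rV[R]_N) :
  mean u = N%:R^-1 * dotv (const_mx 1) u.
Proof. by congr (_ * _); apply: eq_bigr => i _; rewrite mxE mul1r. Qed.

Lemma deviation2E (R : realType) N (Q : 'rV[R]_N) :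
  deviation 2 Q = enorm (Q - mean Q *: const_mx 1).
Proof.
rewrite /deviation powR12_sqrt; last by apply: sumr_ge0 => i _; exact: powR_ge0.
congr Num.sqrt; apply: eq_bigr => i _.
by rewrite !mxE mulr1 powR_mulrn// real_normK ?num_real.
Qed.

(** In dimension 0 the deviation is the root of an empty sum, hence 0. This is what licenses
    division by [N] later on. *)
Lemma deviation2_neq0_dim (R : realType) N (Q : 'rV[R]_N) :
  deviation 2 Q != 0 -> N%:R != 0 :> R.
Proof.
case: N Q => [|N] Q; last by rewrite pnatr_eq0.
by rewrite deviation2E /enorm /dotv big_ord0 sqrtr0 eqxx.
Qed.

Lemma standardizeE (R : realType) N (Q : 'rV[R]_N) a b :
  standardize Q a b = b^-1 *: (Q - a *: const_mx 1).
Proof. by apply/rowP => i; rewrite !mxE mulr1 mulrC. Qed.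

Lemma dotv_one_one (R : realType) N :
  dotv (const_mx 1 : 'rV[R]_N) (const_mx 1) = N%:R.
Proof.
rewrite /dotv; under eq_bigr do rewrite mxE mulr1.
by rewrite sumr_const card_ord.
Qed.

Lemma dotv_one_centered (R : realType) N (Q : 'rV[R]_N) :
  N%:R != 0 :> R -> dotv (const_mx 1) (Q - mean Q *: const_mx 1) = 0.
Proof. by move=> N0; rewrite dotvBr dotvZr dotv_one_one meanE; field. Qed.

Lemma dotv_one_normalize (R : realType) N (Q : 'rV[R]_N) :
  deviation 2 Q != 0 -> dotv (const_mx 1) (normalize 2 Q) = 0.
Proof.
move=> /deviation2_neq0_dim N0.
by rewrite /normalize standardizeE dotvZr dotv_one_centered// mulr0.
Qed.

Lemma dotv_normalize (R : realType) N (Q : 'rV[R]_N) :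
  deviation 2 Q != 0 -> dotv (normalize 2 Q) (normalize 2 Q) = 1.
Proof.
move=> b0; rewrite /normalize standardizeE dotvZl dotvZr -enorm_sqr.
rewrite -deviation2E.
by field.
Qed.

(** * Differential calculus: coordinates, sums, gradients, inner products *)

Lemma is_diff_coord (R : realType) N (X : 'rV[R]_N) i :
  is_diff X (fun Y : 'rV[R]_N => Y 0 i) (fun v : 'rV[R]_N => v 0 i).
Proof.
(* The coordinate map is bundled as a linear map, so that its continuity yields both
   differentiability and the fact that it is its own differential. *)
have @f : {linear 'rV[R]_N -> R}.
  by exists (fun Y : 'rV[R]_N => Y 0 i); do 2![eexists]; do ?[constructor];
     rewrite ?mxE// => ? *; rewrite ?mxE//; move=> ?; rewrite !mxE.
rewrite (_ : (fun _ => _) = f) //; split.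
  by apply: linear_differentiable; exact: coord_continuous.
by rewrite diff_lin //; exact: coord_continuous.
Qed.

Lemma is_diff_sum (R : realType) (V W : normedModType R) n
    (f df : 'I_n -> V -> W) (x : V) :
  (forall i, is_diff x (f i) (df i)) ->
  is_diff x (fun y => \sum_(i < n) f i y) (fun v => \sum_(i < n) df i v).
Proof.
move=> fdf; rewrite -!fct_sumE.
elim/big_ind2 : _ => [|? ? ? ? ? ?|i _]; [exact: is_diff_cst|exact: is_diffD|].
exact: fdf.
Qed.

(** Chain rule in gradient form: at a point of differentiability, the differential of [f] is the
    inner product with [gradient f], as expanding [dh v] in the standard basis shows. The space [V]
    is general so that [h] may depend on a whole vector or on a single statistic. *)
Lemma gradientP (R : realType) N (V : normedModType R) (f : 'rV[R]_N -> R)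
    (h dh : V -> 'rV[R]_N) (x : V) :
  is_diff x h dh -> differentiable f (h x) ->
  is_diff x (f \o h) (fun v => dotv (gradient f (h x)) (dh v)).
Proof.
move=> hdh fx.
have -> : (fun v => dotv (gradient f (h x)) (dh v)) = 'd f (h x) \o dh.
  apply/funext => v /=; rewrite [in RHS](row_sum_delta (dh v)) linear_sum.
  by apply: eq_bigr => i _; rewrite mxE deriveE// linearZ mulrC.
by apply: is_diff_comp; exact: differentiableP.
Qed.

Lemma gradient_is_diff (R : realType) N (f df : 'rV[R]_N -> R) X :
  is_diff X f df -> gradient f X = \row_i df (delta_mx 0 i).
Proof.
by move=> fdf; apply/rowP => i; rewrite !mxE deriveE ?diff_val.
Qed.

Lemma is_diff_dotv (R : realType) N (V : normedModType R)
    (f df g dg : V -> 'rV[R]_N) (x : V) :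
  is_diff x f df -> is_diff x g dg ->
  is_diff x (fun y => dotv (f y) (g y))
    (fun v => dotv (f x) (dg v) + dotv (df v) (g x)).
Proof.
move=> fdf gdg.
have coordP (h dh : V -> 'rV[R]_N) i : is_diff x h dh ->
    is_diff x (fun y => h y 0 i) (fun v => dh v 0 i).
  by move=> hdh; apply: (is_diff_comp _ (is_diff_coord (h x) i)).
have sumP : is_diff x (fun y => dotv (f y) (g y))
    (fun v => \sum_(i < N) (f x 0 i * dg v 0 i + g x 0 i * df v 0 i)).
  apply: is_diff_sum => i.
  exact: (is_diffM (coordP f df i fdf) (coordP g dg i gdg)).
apply: (is_diff_eq sumP); apply/funext => v.
rewrite -big_split; apply: eq_bigr => i _.
by congr (_ + _); rewrite mulrC.
Qed.

(** * Differentials of the statistics and of the standardization *)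

Lemma is_diff_mean (R : realType) N (Q : 'rV[R]_N) :
  is_diff Q (@mean R N) (@mean R N).
Proof. by apply: is_diffZ; apply: is_diff_sum => i; exact: is_diff_coord. Qed.

Lemma is_derive_diff (R : realType) (U : normedModType R) (f : R -> U)
    (x : R) df :
  is_derive x (1 : R) f df -> is_diff x f (fun h => h *: df).
Proof.
move=> fdf; have fx : differentiable f x.
  by apply/derivable1_diffP; exact: ex_derive.
by split=> //; rewrite diff1E// derive1E derive_val.
Qed.

(** The deviation is the Euclidean norm of the centered vector, and the norm has the unit vector as
    gradient. Centering the direction [v] changes nothing, because the centered vector is orthogonal
    to 1. *)
Lemma is_diff_deviation (R : realType) N (Q : 'rV[R]_N) :
  deviation 2 Q != 0 ->
  is_diff Q (@deviation R N 2) (fun v => dotv (normalize 2 Q) v).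
Proof.
move=> b0; have N0 := deviation2_neq0_dim b0.
rewrite (_ : @deviation R N 2 = Num.sqrt \o
    (fun Y => dotv (Y - mean Y *: const_mx 1) (Y - mean Y *: const_mx 1)));
  last by apply/funext => Y; rewrite deviation2E.
have centerP : is_diff Q (fun Y : 'rV[R]_N => Y - mean Y *: const_mx 1)
    (fun v : 'rV[R]_N => v - mean v *: const_mx 1).
  apply: is_diffB.
  apply: (is_diff_comp (is_diff_mean Q)
    (is_diff_scalel (mean Q) (const_mx 1 : 'rV[R]_N))).
(* The square root is differentiated only at a positive argument; this is where the nonzero
   deviation enters. *)
have c0 : 0 < dotv (Q - mean Q *: const_mx 1) (Q - mean Q *: const_mx 1).
  by rewrite -enorm_sqr -deviation2E exprn_even_gt0.
apply: (is_diff_eq (is_diff_comp (is_diff_dotv centerP centerP)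
  (is_derive_diff (is_derive1_sqrt c0)))).
apply/funext => v /=.
rewrite -[Num.sqrt _]/(enorm _) -deviation2E.
(* The two terms of the product rule coincide; their sum cancels the factor 2 in the derivative of
   the root. *)
rewrite (dotvC (_ - _) (Q - _)) dotvBr dotvZr.
rewrite [in X in _ * X](dotvC _ (const_mx 1)).
rewrite dotv_one_centered// mulr0 subr0 /normalize standardizeE dotvZl.
rewrite -[_ *: _]/(_ * _).
by field.
Qed.

Lemma is_diff_row (R : realType) N (V : normedModType R)
    (f df : 'I_N -> V -> R) (x : V) :
  (forall i, is_diff x (f i) (df i)) ->
  is_diff x (fun y => \row_i f i y) (fun v => \row_i df i v).
Proof.
move=> fdf.
have rowE (h : 'I_N -> V -> R) :
    (fun y => \row_i h i y) = (fun y => \sum_i h i y *: delta_mx 0 i).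
  apply/funext => y; rewrite [LHS]row_sum_delta.
  by apply: eq_bigr => i _; rewrite mxE.
rewrite !rowE; apply: is_diff_sum => i.
exact: (is_diff_comp (fdf i)
  (is_diff_scalel (f i x) (delta_mx 0 i : 'rV[R]_N))).
Qed.

(** Quotient rule in each coordinate. Keeping [F], [A] and [B] as arbitrary functions covers the
    full normalization as well as the variation of one statistic with the rest constant. *)
Lemma is_diff_standardize (R : realType) N (V : normedModType R)
    (F dF : V -> 'rV[R]_N) (A dA B dB : V -> R) (x : V) :
  B x != 0 -> is_diff x F dF -> is_diff x A dA -> is_diff x B dB ->
  is_diff x (fun y => standardize (F y) (A y) (B y))
    (fun v => (B x)^-1 *: (dF v - dA v *: const_mx 1
                           - dB v *: standardize (F x) (A x) (B x))).
Proof.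
move=> B0 FdF AdA BdB.
have invP : is_diff x (fun y => (B y)^-1) (fun v => - (B x) ^- 2 * dB v).
  split; first exact/differentiableV/B0/ex_diff.
  by rewrite diffV// diff_val.
have entryP i := is_diffM
  (is_diffB (is_diff_comp FdF (is_diff_coord (F x) i)) AdA) invP.
apply: (is_diff_eq (is_diff_row entryP)).
apply/funext => v; apply/rowP => i; rewrite !mxE.
rewrite -[LHS]/(_ * (_ * _) + _ * (_ - _)) !fctE /=.
by field.
Qed.

(** * Squared norm of the gradient and contributions of the paths *)

(** Orthogonality of 1 and [S] removes the product of [c] and [d]. The weights are left free, so one
    expansion serves both for the gradient magnitude and for the independence of the two paths. *)
Lemma enorm_sqr_path_sum (R : realType) N (g S : 'rV[R]_N) b c d :
  b != 0 -> N%:R != 0 :> R -> dotv (const_mx 1) S = 0 -> dotv S S = 1 ->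
  enorm (b^-1 *: g + c *: const_mx N%:R^-1 + d *: S) ^+ 2 =
  (b ^+ 2)^-1 * enorm g ^+ 2
    + (c ^+ 2 + 2 * c * (b^-1 * dotv (const_mx 1) g)) / N%:R
    + (d ^+ 2 + 2 * d * (b^-1 * dotv g S)).
Proof.
move=> b0 N0 oneS SS; rewrite !enorm_sqr.
rewrite (_ : const_mx N%:R^-1 = N%:R^-1 *: const_mx 1 :> 'rV[R]_N); last first.
  by apply/rowP => i; rewrite !mxE mulr1.
rewrite !(dotvDl, dotvDr, dotvZl, dotvZr) !(dotvC _ (const_mx 1)) (dotvC S g).
rewrite dotv_one_one oneS SS; field.
by rewrite b0 N0.
Qed.

Theorem theorem1 (R : realType) (N : nat) (p : R) (Qhat Q : 'rV[R]_N)
    (hp : 1 <= p)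
    (hbhat : deviation 2 Qhat != 0)
    (hb : deviation 2 Q != 0)
    (hdiff : differentiable (@score_loss R N p 2 (normalize 2 Q))
                            (normalize 2 Qhat)) :
  let ahat := mean Qhat in
  let bhat := deviation 2 Qhat in
  let Shat := normalize 2 Qhat in
  let S := normalize 2 Q in
  let l := fun X : 'rV[R]_N => nin_loss p 2 X Q in
  let g := gradient (@score_loss R N p 2 S) Shat in
  let gn := gradient l Qhat in
  let da := (loss_of_mean p 2 Qhat Q)^`() ahat in
  let db := (loss_of_deviation p 2 Qhat Q)^`() bhat in
  let T1 := enorm g ^+ 2 in
  let T2 := - (N%:R^-1 * dotv (const_mx 1) g ^+ 2) in
  let T3 := - (dotv g Shat ^+ 2) in
  (* the gradient magnitude *)
  (differentiable l Qhat /\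
   enorm gn ^+ 2 = (bhat ^+ 2)^-1 * (T1 + T2 + T3)) /\
  (* the signs of the last two terms *)
  (T2 <= 0 /\ T3 <= 0) /\
  (* the derivatives with respect to the statistics *)
  (is_derive ahat 1 (loss_of_mean p 2 Qhat Q)
     (- (bhat^-1 * dotv (const_mx 1) g)) /\
   is_derive bhat 1 (loss_of_deviation p 2 Qhat Q)
     (- (bhat^-1 * dotv g Shat))) /\
  (* the second term involves only da, the third only db *)
  (T2 = - (bhat ^+ 2 / N%:R * da ^+ 2) /\
   T3 = - (bhat ^+ 2 * db ^+ 2)) /\
  (* each of them is what the path through that statistic adds to the squared
     gradient magnitude, whatever the weight of the other path *)
  (gn = backprop 2 Qhat g da db /\
   (forall y : R, enorm (backprop 2 Qhat g da y) ^+ 2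
                  - enorm (backprop 2 Qhat g 0 y) ^+ 2
                  = (bhat ^+ 2)^-1 * T2) /\
   (forall x : R, enorm (backprop 2 Qhat g x db) ^+ 2
                  - enorm (backprop 2 Qhat g x 0) ^+ 2
                  = (bhat ^+ 2)^-1 * T3)).
Proof.
move=> ahat bhat Shat S l g gn da db T1 T2 T3.
have b0 : bhat != 0 := hbhat.
have N0 := deviation2_neq0_dim hbhat.
have oneS : dotv (const_mx 1) Shat = 0 := dotv_one_normalize hbhat.
have SS : dotv Shat Shat = 1 := dotv_normalize hbhat.
have lP : is_diff Qhat l (fun v => dotv g (bhat^-1 *:
    (v - mean v *: const_mx 1 - dotv Shat v *: Shat))).
  apply: gradientP hdiff.
  exact: (is_diff_standardize hbhat (is_diff_id Qhat) (is_diff_mean Qhat)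
    (is_diff_deviation hbhat)).
have aP : is_derive ahat 1 (loss_of_mean p 2 Qhat Q)
     (- (bhat^-1 * dotv (const_mx 1) g)).
  (* Only the mean varies here, so the standardized vector moves with velocity
     [- bhat^-1 *: const_mx 1]. *)
  have H := gradientP (is_diff_standardize (B := cst bhat) (x := ahat) hbhat
    (is_diff_cst Qhat ahat) (is_diff_id ahat) (is_diff_cst bhat ahat)) hdiff.
  split; first by apply: diff_derivable; exact: ex_diff.
  rewrite deriveE ?diff_val; last exact: ex_diff.
  rewrite /= scale1r scale0r subr0 sub0r dotvZr -scaleN1r dotvZr dotvC.
  by rewrite mulN1r mulrN.
have bP : is_derive bhat 1 (loss_of_deviation p 2 Qhat Q)
     (- (bhat^-1 * dotv g Shat)).
  have H := gradientP (is_diff_standardize (B := id) (x := bhat) hbhat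
    (is_diff_cst Qhat bhat) (is_diff_cst ahat bhat) (is_diff_id bhat)) hdiff.
  split; first by apply: diff_derivable; exact: ex_diff.
  rewrite deriveE ?diff_val; last exact: ex_diff.
  rewrite /= scale1r scale0r subr0 sub0r dotvZr -scaleN1r dotvZr.
  by rewrite mulN1r mulrN.
have daE : da = - (bhat^-1 * dotv (const_mx 1) g).
  by rewrite /da derive1E; exact: derive_val.
have dbE : db = - (bhat^-1 * dotv g Shat).
  by rewrite /db derive1E; exact: derive_val.
have bpE x y : backprop 2 Qhat g x y
    = bhat^-1 *: g + x *: const_mx N%:R^-1 + y *: Shat.
  rewrite /backprop (gradient_is_diff (is_diff_mean Qhat)).
  rewrite (gradient_is_diff (is_diff_deviation hbhat)).
  congr (_ + _ *: _ + _ *: _); apply/rowP => i; rewrite mxE.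
    by rewrite meanE dotv_delta !mxE mulr1.
  exact: dotv_delta.
have gnE : gn = backprop 2 Qhat g da db.
  (* Evaluating the differential at basis vectors applies the transposed Jacobian to [g]; the
     Jacobian is symmetric, and its three terms match the three paths. *)
  rewrite bpE daE dbE /gn (gradient_is_diff lP).
  move: (g) (Shat) (bhat^-1) => u v c; apply/rowP => i.
  rewrite !mxE meanE !(dotvZr, dotvBr) !dotv_delta mxE (dotvC u (const_mx 1)).
  by move: (dotv u v) (dotv _ u) (N%:R^-1 : R) => *; ring.
have bpN x y := enorm_sqr_path_sum g x y b0 N0 oneS SS.
split; [split; first exact: ex_diff|split; [split|split;
  [|split; [split|split=> //; split]]]].
(* At [c = da] the factor [bhat^-1 * dotv (const_mx 1) g] is [- c], so the mean path adds (c^2 - 2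
   c^2) / N = - c^2 / N; likewise [d = db] adds - d^2. *)
- rewrite gnE bpE bpN daE dbE /T1 /T2 /T3.
  move: (dotv g Shat) (dotv _ g) (enorm g ^+ 2) (bhat) b0 (N%:R : R) N0.
  by move=> u v w b b0 n n0; field; rewrite b0 ?n0.
- by rewrite oppr_le0 mulr_ge0// ?sqr_ge0// invr_ge0.
- by rewrite oppr_le0 sqr_ge0.
- by split.
- rewrite daE /T2; move: (dotv _ g) (bhat) b0 (N%:R : R) N0 => v b b0 n n0.
  by field; rewrite b0 ?n0.
- by rewrite dbE /T3; move: (dotv g Shat) (bhat) b0 => u b b0; field.
(* All terms in [y] cancel in the difference, since none of them involves the other weight. *)
- move=> y; rewrite !bpE !bpN daE /T2.
  move: (dotv g Shat) (dotv _ g) (enorm g ^+ 2) (bhat) b0 (N%:R : R) N0.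
  by move=> u v w b b0 n n0; field; rewrite b0 ?n0.
- move=> x; rewrite !bpE !bpN dbE /T3.
  move: (dotv g Shat) (dotv _ g) (enorm g ^+ 2) (bhat) b0 (N%:R : R) N0.
  by move=> u v w b b0 n n0; field; rewrite b0 ?n0.
Qed.
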